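(* Let $n$ be even, let $A=(a_{ij})_{n\times n}$ be a real skew symmetric matrix of order $n$, and let $E=\{(i_l,j_l)\mid l=1,2,\ldots,k\}$ be a non-empty set of $k$ distinct pairs in $[n]\times[n]$ such that $i_1\le i_2\le\cdots\le i_k$ and $i_l<j_l$ for all $l\in[k]$. Then, for any fixed $p\in[k]$, $$Pf(E(A))\,Pf(A)=Pf(E_p(A))\,Pf(\overline{E_p}(A))+a_{i_pj_p}\sum_{1\le l\le k,\ l\ne p}a_{i_lj_l}\Big[f(p,l)\,Pf(E(A)_{\{j_p,i_l\}})\,Pf(A_{\{i_p,j_l\}})-g(p,l)\,Pf(E(A)_{\{j_p,j_l\}})\,Pf(A_{\{i_p,i_l\}})\Big],$$ where $E_p=E\setminus\{(i_p,j_p)\}$, $\overline{E_p}=\{(i_p,j_p)\}$, $f(p,l)=s([n],i_pj_l)\,s([n],j_pi_l)$ and $g(p,l)=s([n],i_pi_l)\,s([n],j_pj_l)$.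
   Context: Notation: $[n]=\{1,2,\ldots,n\}$; when used as a word, $[n]$ means the word $12\cdots n$. Pfaffian: for a skew symmetric matrix $A=(a_{ij})$ of even order $n$, $Pf(A)=\sum_\pi b_\pi$, where $\pi=\{\{s_1,t_1\},\ldots,\{s_{n/2},t_{n/2}\}\}$ ranges over all partitions of $[n]$ into pairs and $b_\pi=\mathrm{sgn}(s_1t_1s_2t_2\cdots s_{n/2}t_{n/2})\prod_{l=1}^{n/2}a_{s_lt_l}$ (independent of the order of pairs and of the order within each pair). The Pfaffian of a skew symmetric matrix of odd order is defined to be $0$. For $I\subseteq[n]$, $A_I$ denotes the matrix obtained from $A$ by deleting the rows and columns indexed by $I$ (the remaining indices kept in increasing order). For a set $E$ of pairs $(i,j)\in[n]\times[n]$ with $i<j$, $E(A)$ denotes the skew symmetric matrix obtained from $A$ by replacing the $(i,j)$- and $(j,i)$-entries by $0$ for every $(i,j)\in E$, leaving all other entries unchanged (so $E(A)=A$ if $E=\emptyset$). $E(A)_I$ means $(E(A))_I$. For words $\alpha,\beta$: $s(\alpha,\beta)=0$ if $\alpha$ or $\beta$ has a repeated letter, or if $\beta$ contains a letter not in $\alpha$; otherwise $s(\alpha,\beta)$ is the sign of the permutation taking $\alpha$ into the word $\beta(\alpha\setminus\beta)$, where $\alpha\setminus\beta$ is the word that remains when the letters of $\beta$ are removed from $\alpha$. *)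

(* Defs.v *)
From mathcomp Require Export all_boot all_order all_algebra all_fingroup.
From mathcomp Require Export reals.

Set Implicit Arguments.
Unset Strict Implicit.
Unset Printing Implicit Defensive.

Import GRing.Theory.
Local Open Scope ring_scope.

(* The sign of the permutation taking the word a into the word b. When a has no
   repeated letter there is at most one such permutation of the positions of a;
   the value is 0 when b is not a rearrangement of a. *)
Definition rearr_sign (T : eqType) (a b : seq T) : int :=
  if [pick p : 'S_(size a) |
        b == [seq tnth (in_tuple a) (p k) | k <- enum 'I_(size a)]] is Some p
  then (-1) ^+ p else 0.

(* The symbol s(a, b) on words; the filtered word is a \ b. *)
Definition word_sign (T : eqType) (a b : seq T) : int :=
  if [&& uniq a, uniq b & all (mem a) b]
  then rearr_sign a (b ++ [seq x <- a | x \notin b]) else 0.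

(* The word 1 2 ... n; the letters are 0, ..., n - 1 here. *)
Definition id_word (n : nat) : seq 'I_n := enum 'I_n.

Section Pfaffian.
Variables (R : comNzRingType) (n : nat).
Implicit Types (A : 'M[R]_n) (P : {set {set 'I_n}}).

Definition pair_partition P : bool :=
  partition P [set: 'I_n] && [forall B in P, #|B| == 2%N].

(* s_1 t_1 s_2 t_2 ... with s_l < t_l in each pair, since enum lists the
   elements of a set of ordinals in increasing order. *)
Definition pair_word P : seq 'I_n := flatten [seq enum B | B : {set 'I_n} <- enum P].

(* a_{st} for B = {s, t} with s < t; the default is never used on a pair. *)
Definition pair_entry A (B : {set 'I_n}) : R :=
  if enum B is [:: s; t] then A s t else 0.

Definition Pf A : R :=
  if odd n then 0
  else \sum_(P : {set {set 'I_n}} | pair_partition P)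
         (rearr_sign (id_word n) (pair_word P))%:~R
         * \prod_(B in P) pair_entry A B.

(* A_I: enum_val enumerates the complement of I increasingly. *)
Definition del_mx A (I : {set 'I_n}) : 'M[R]_#|~: I| :=
  mxsub enum_val enum_val A.

Definition zero_mx (E : {set 'I_n * 'I_n}) A : 'M[R]_n :=
  \matrix_(i, j) if ((i, j) \in E) || ((j, i) \in E) then 0 else A i j.

End Pfaffian.

(* Main.v *)
(** The matrix [pf_adj A s t], equal to [s([n], st) Pf(A_{st})], is skew
    symmetric and satisfies [A pf_adj(A)^T = Pf(A) I]: on the diagonal this is
    the expansion of [Pf A] along a row, and off the diagonal it is the
    expansion of a Pfaffian with two equal rows.  Computing
    [sum_{u,v} (A - B)_{uv} pf_adj(A)_{su} pf_adj(B)_{tv}] in two ways then gives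
    [Pf(A) pf_adj(B)_{st} - Pf(B) pf_adj(A)_{st}].  For [B = E(A)] only the
    entries of [E] contribute to the sum.  With [(s, t) = (i_p, j_p)], the
    Pfaffians of [E_p(A)] and of the matrix with the single entry [(s, t)]
    erased differ from [Pf B] and [Pf A] by one term of the row expansion along
    [s], and the identity follows by algebra, the summand of index [p]
    accounting for the quadratic term in [a_{i_p j_p}]. *)
Require Import Defs.
From mathcomp Require Import ring.

Set Implicit Arguments.
Unset Strict Implicit.
Unset Printing Implicit Defensive.

Import GRing.Theory Num.Theory.

Local Open Scope ring_scope.

(** * Inversions and signs of words *)

(** The inversions of [v ++ w] between a letter of [v] and a letter of [w]. Unlike [inversions],
    this number ignores the order inside each word. *)
Definition cross_inv (v w : seq nat) : nat :=
  \sum_(x <- v) count (fun y => (y < x)%N) w.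

Fixpoint inversions (w : seq nat) : nat :=
  if w is x :: w' then (count (fun y => (y < x)%N) w' + inversions w')%N else 0%N.

Lemma perm_cross_inv v v' w w' :
  perm_eq v v' -> perm_eq w w' -> cross_inv v w = cross_inv v' w'.
Proof.
move=> pv pw; rewrite /cross_inv (perm_big _ pv) /=.
by apply: eq_bigr => x _; apply/seq.permP.
Qed.

Lemma cross_inv_catl u v w :
  cross_inv (u ++ v) w = (cross_inv u w + cross_inv v w)%N.
Proof. by rewrite /cross_inv big_cat. Qed.

Lemma cross_inv_catr u v w :
  cross_inv u (v ++ w) = (cross_inv u v + cross_inv u w)%N.
Proof.
by rewrite /cross_inv -big_split; apply: eq_bigr => x _; rewrite count_cat.
Qed.

Lemma inv_cat v w : inversions (v ++ w) = (inversions v + inversions w + cross_inv v w)%N.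
Proof.
elim: v => [|x v IH] /=; first by rewrite /cross_inv big_nil addn0.
rewrite IH count_cat {2}/cross_inv big_cons -/(cross_inv v w).
by rewrite -!addnA; congr (_ + _)%N; rewrite addnCA; congr (_ + _)%N; rewrite addnCA.
Qed.

(** A letter of [v] and a letter of [w] are distinct, so each such pair is counted by exactly one of
    the two summands. *)
Lemma cross_invC v w : ~~ has (mem v) w ->
  (cross_inv v w + cross_inv w v)%N = (size v * size w)%N.
Proof.
elim: v => [|x v IH].
  by move=> _; rewrite /cross_inv big_nil big1.
move=> h; have /andP[xw vw]: (x \notin w) && ~~ has (mem v) w.
  apply/andP; split; first by apply: contra h => xw; apply/hasP; exists x => //=; rewrite inE eqxx.
  by apply: contra h => /hasP[y yw yv]; apply/hasP; exists y => //=; rewrite inE; apply/orP; right.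
rewrite -cat1s cross_inv_catl cross_inv_catr addnACA IH // size_cat mulnDl; congr (_ + _)%N.
rewrite /cross_inv big_seq1 mul1n -(count_predC (fun y => (y < x)%N) w); congr (_ + _)%N.
rewrite -sum1_count [RHS]big_mkcond /= big_seq [RHS]big_seq; apply: eq_bigr => y yw.
have: y != x by apply: contraNneq xw => <-.
by rewrite addn0; case: ltngtP.
Qed.

Lemma inv_map_mono (T : Type) (f g : T -> nat) (w : seq T) :
  (forall x y, (f x < f y)%N = (g x < g y)%N) -> inversions (map f w) = inversions (map g w).
Proof.
move=> fg; elim: w => //= x w ->; congr (_ + _)%N.
by rewrite !count_map; apply: eq_count => y /=.
Qed.

Lemma sorted_inv w : sorted ltn w -> inversions w = 0%N.
Proof.
elim: w => //= x w IH; rewrite path_sortedE; last by move=> a b c; apply: ltn_trans.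
case/andP=> /allP xw /IH ->; rewrite addn0; apply/eqP; rewrite -leqn0 leqNgt -has_count.
by apply/hasPn => y /xw /=; case: ltngtP.
Qed.

(** Only the cross inversions of [u] and [v] change, and by [cross_invC] the two counts have the
    same parity when the product of the lengths is even. *)
Lemma odd_inv_catCA (u v w : seq nat) :
  ~~ has (mem u) v -> ~~ odd (size u * size v) ->
  odd (inversions (u ++ v ++ w)) = odd (inversions (v ++ u ++ w)).
Proof.
move=> uv; rewrite -(cross_invC uv) !inv_cat !cross_inv_catr !oddD.
by case: (odd (cross_inv u v)); case: (odd (cross_inv v u)) => //= _;
  case: (odd (inversions u)); case: (odd (inversions v)); case: (odd (inversions w));
  case: (odd (cross_inv u w)); case: (odd (cross_inv v w)).
Qed.

(* Each letter of [v] changes sides of both [x] and [y], which is an even number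
   of changes; only the pair [x], [y] itself matters. *)
Lemma odd_inv_swap (u v w : seq nat) (x y : nat) :
  x != y -> x \notin v -> y \notin v ->
  odd (inversions (u ++ y :: v ++ x :: w)) = ~~ odd (inversions (u ++ x :: v ++ y :: w)).
Proof.
move=> xy xv yv.
have E a b : u ++ a :: v ++ b :: w = u ++ ([:: a] ++ v ++ [:: b]) ++ w by rewrite -!catA.
have pxy : perm_eq ([:: y] ++ v ++ [:: x]) ([:: x] ++ v ++ [:: y]).
  by rewrite perm_catC -catA perm_sym perm_catC -catA perm_cat2l perm_catC.
suff : odd (inversions ([:: y] ++ v ++ [:: x])) = ~~ odd (inversions ([:: x] ++ v ++ [:: y])).
  rewrite !E; move: pxy; set a := _ ++ v ++ _; set b := _ ++ v ++ _ => pab odd_ab.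
  rewrite !(inv_cat u) (inv_cat a) (inv_cat b) (perm_cross_inv pab (perm_refl w)).
  rewrite (@perm_cross_inv u u (a ++ w) (b ++ w)) ?perm_cat2r //.
  by clearbody a b; rewrite !oddD odd_ab; case: (odd (inversions u)); case: (odd (inversions b));
    case: (odd (inversions w)); case: (odd (cross_inv b w)); case: (odd (cross_inv u _)).
rewrite !inv_cat !cross_inv_catr !oddD /=.
have cv a : a \notin v -> odd (cross_inv [:: a] v) = odd (size v) (+) odd (cross_inv v [:: a]).
  move=> av; rewrite -(mul1n (size v)) -(@cross_invC [:: a]) ?oddD; last first.
    by apply: contra av => /hasP[b bv]; rewrite /= inE => /eqP <-.
  by rewrite -addbA addbb addbF.
rewrite !cv // /cross_inv !big_seq1 /= !addn0.
by move: xy; case: ltngtP => // _ _ /=; rewrite ?addn0 ?addn1;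
  case: (odd (size v)); case: (odd (inversions v));
  case: (odd (cross_inv v [:: x])); case: (odd (cross_inv v [:: y])).
Qed.

Section OrdWord.
Variable n : nat.
Implicit Types (w : seq 'I_n) (s : 'S_n).

Definition ord_inversions w : nat := inversions (map val w).

(** Acting on letters, the transposition exchanges the single occurrences of [x] and [y]. Splitting
    [w] at both letters reduces this to [odd_inv_swap]. *)
Lemma odd_oinv_tperm w (x y : 'I_n) : uniq w -> x \in w -> y \in w -> x != y ->
  odd (ord_inversions (map (tperm x y) w)) = ~~ odd (ord_inversions w).
Proof.
move=> uw; wlog: x y / (index x w < index y w)%N => [IH xw yw xy|].
  case: (ltngtP (index x w) (index y w)) => h; first exact: IH.
    by rewrite tpermC; apply: IH; rewrite // eq_sym.
  by case/eqP: xy; apply: index_inj xw yw h.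
move=> lt_xy xw; case/splitPr: xw uw lt_xy => u r.
rewrite cat_uniq /= => /and3P[uu nur /andP[xr ur]].
rewrite !index_cat /= eqxx addn0.
have xu : x \notin u by apply: contra nur => xu; apply/orP; left.
rewrite (negPf xu); case: ifP => [yu|yu].
  by rewrite ltnNge ltnW // index_mem.
case: eqP => [_|/eqP xy _]; first by rewrite addn0 ltnn.
rewrite mem_cat yu inE /= => /orP[/eqP yx|yr _]; first by rewrite yx eqxx in xy.
case/splitPr: yr xr ur nur => v z.
rewrite mem_cat inE => /norP[xv /norP[_ xz]].
rewrite cat_uniq /= => /and3P[uv /norP[yv _] /andP[yz _]] _.
have idw t : x \notin t -> y \notin t -> map (tperm x y) t = t.
  move=> xt yt; apply: map_id_in => a at_; rewrite tpermD //.
    by apply: contraNneq xt => ->.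
  by apply: contraNneq yt => ->.
rewrite !map_cat /= !map_cat /= tpermL tpermR !idw ?yu //.
rewrite /ord_inversions !map_cat /= !map_cat /=; apply: odd_inv_swap.
- by apply: contraNneq xy => /val_inj ->.
- by rewrite mem_map //; apply: val_inj.
- by rewrite mem_map //; apply: val_inj.
Qed.

(** Induction on a factorization of [s] into transpositions, with [w] general because the first
    factor already rearranges it. *)
Lemma odd_oinv_perm s w : perm_eq w (enum 'I_n) ->
  odd (ord_inversions (map s w)) = s (+) odd (ord_inversions w).
Proof.
move=> pw; have [ts -> _] := prod_tpermP s.
elim: ts w pw {s} => [|t ts IH] w pw.
  rewrite big_nil odd_perm1; congr (odd (ord_inversions _)).
  by apply: map_id_in => x _; rewrite perm1.
rewrite big_cons odd_mul_tperm.
have -> : map (tperm t.1 t.2 * \prod_(j <- ts) tperm j.1 j.2)%g w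
    = map (\prod_(j <- ts) tperm j.1 j.2)%g (map (tperm t.1 t.2) w).
  by rewrite -map_comp; apply: eq_map => x /=; rewrite permM.
rewrite IH; last first.
  apply: uniq_perm; rewrite ?enum_uniq //.
    by rewrite map_inj_uniq ?(perm_uniq pw) ?enum_uniq //; apply: perm_inj.
  move=> x; rewrite mem_enum -[x](tpermK t.1 t.2) mem_map; last exact: perm_inj.
  by rewrite (perm_mem pw) mem_enum.
have [->|ne] := eqVneq t.1 t.2.
  rewrite addFb; congr (_ (+) odd (ord_inversions _)).
  by apply: map_id_in => x _; rewrite tperm1 perm1.
rewrite odd_oinv_tperm ?(perm_mem pw) ?(perm_uniq pw) ?enum_uniq ?mem_enum //.
by rewrite addbN addTb addNb.
Qed.

Lemma oinv_enum : ord_inversions (enum 'I_n) = 0%N.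
Proof. by rewrite /ord_inversions val_enum_ord sorted_inv // iota_ltn_sorted. Qed.
End OrdWord.

Lemma rearr_signE n (w : seq 'I_n) : perm_eq w (enum 'I_n) ->
  rearr_sign (id_word n) w = (-1) ^+ ord_inversions w.
Proof.
move=> pw; rewrite /rearr_sign /id_word.
case: pickP => [p /eqP Ew|noP]; last first.
  have /tuple_permP[p Ep] : perm_eq w (in_tuple (enum 'I_n)) by [].
  by have := noP p; rewrite Ep /= eqxx.
rewrite -[in RHS]signr_odd; congr (_ ^+ _).
(* The increasing word has no inversions, so the parity of [p] is that of the image word. Position
   [k] of the increasing word carries the letter [k], so acting on positions and acting on letters
   agree. *)
rewrite -[odd_perm p]addbF -[X in _ (+) X]/(odd 0) -(oinv_enum (size (enum 'I_n))).
rewrite -odd_oinv_perm //; congr (odd (inversions _) : nat).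
rewrite Ew -!map_comp; apply: eq_map => k /=.
rewrite (tnth_nth (tnth (in_tuple (enum 'I_n)) (p k))) /= nth_enum_ord //.
by have := ltn_ord (p k); rewrite [X in (_ < X)%N]size_enum_ord.
Qed.

(** * Terms of the Pfaffian as words *)

Lemma sorted_val_enum n (B : {set 'I_n}) : sorted ltn (map val (enum B)).
Proof.
have -> : map val (enum B) = filter (mem (map val (enum B))) (iota 0 n).
  rewrite -val_enum_ord filter_map; congr map.
  rewrite {1}/enum_mem -enumT; apply: eq_filter => x /=.
  by rewrite mem_map ?mem_enum //; apply: val_inj.
exact: sorted_filter ltn_trans _ _ (iota_ltn_sorted 0 n).
Qed.

(** Used to carry inversion counts from the relabelled indices of a deleted matrix back to [[n]]. *)
Lemma enum_val_ltn n (D : {set 'I_n}) (a b : 'I_#|D|) :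
  (val (enum_val a) < val (enum_val b))%N = (val a < val b)%N.
Proof.
have E (c : 'I_#|D|) : val (enum_val c) = nth 0%N (map val (enum D)) c.
  by rewrite (nth_map (enum_val c)) -?cardE // -enum_val_nth.
have H (c d : 'I_#|D|) : (val c < val d)%N -> (val (enum_val c) < val (enum_val d))%N.
  move=> cd; rewrite !E.
  by apply: (sorted_ltn_nth ltn_trans 0%N (sorted_val_enum D)); rewrite ?inE ?size_map -?cardE.
case: (ltngtP (val a) (val b)) => [/H -> //|/H /ltnW|/val_inj ->].
  by rewrite leqNgt => /negPf.
by rewrite ltnn.
Qed.

Lemma enum_set2 n (s t : 'I_n) : s != t ->
  enum [set s; t] = if (s < t)%N then [:: s; t] else [:: t; s].
Proof.
move=> st; apply: (inj_map val_inj).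
apply: (irr_sorted_eq ltn_trans ltnn); first exact: sorted_val_enum.
  by move: st; case: ltngtP => [st|ts|/val_inj ->] //=; rewrite ?st ?ts ?eqxx.
apply: eq_mem_map => x; rewrite mem_enum !inE.
by case: ifP; rewrite !inE // orbC.
Qed.

Section Terms.
Variables (R : comNzRingType) (n : nat).
Implicit Types (A : 'M[R]_n) (L : seq (seq 'I_n)) (P : {set {set 'I_n}}).

Definition word_entry A (l : seq 'I_n) : R := if l is [:: s; t] then A s t else 0.

(** The summand [b_pi] read off an arbitrary listing [L] of the pairs as two-letter words, so that
    its independence of the listing can be stated and used. *)
Definition word_term A L : R :=
  (-1) ^+ ord_inversions (flatten L) * \prod_(l <- L) word_entry A l.

Definition pairs L := all (fun l => size l == 2) L && uniq (flatten L).

Lemma odd_size_flatten L : all (fun l => size l == 2) L -> ~~ odd (size (flatten L)).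
Proof.
elim: L => //= l L IH /andP[/eqP sl /IH oL].
by rewrite size_cat sl oddD addFb.
Qed.

Lemma perm_pairs L1 L2 : perm_eq L1 L2 -> pairs L1 -> pairs L2.
Proof.
by move=> p12; rewrite /pairs (perm_all _ p12) (perm_uniq (perm_flatten p12)).
Qed.

(** A rearrangement is generated by exchanges of adjacent blocks of pairs. Such blocks flatten to
    words of even length, so [odd_inv_catCA] keeps the sign. *)
Lemma perm_word_term A L1 L2 :
  perm_eq L1 L2 -> pairs L1 -> word_term A L1 = word_term A L2.
Proof.
move=> p12 pL1.
pose good L := pairs L -> word_term A L = word_term A L1.
have /(_ (perm_pairs p12 pL1)) -> // : good L2.
apply: (@catCA_perm_ind _ good) p12 _ => // u v w IH pvuw.
rewrite -IH; last by apply: perm_pairs pvuw; rewrite perm_catCA.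
have /andP[+ uniq_vuw] := pvuw; rewrite !all_cat => /and3P[allv allu _].
rewrite /word_term (perm_big _ (permEl (perm_catCA v u w))) /=; congr (_ * _).
rewrite -signr_odd -[in RHS]signr_odd; congr (_ ^+ (nat_of_bool _)).
rewrite /ord_inversions !flatten_cat !map_cat; apply: odd_inv_catCA.
  move: uniq_vuw; rewrite !flatten_cat catA cat_uniq => /and3P[+ _ _].
  rewrite cat_uniq => /and3P[_ + _]; apply: contra => /hasP[_ /mapP[x xu ->]].
  rewrite /= mem_map => [xv|]; last exact: val_inj.
  by apply/hasP; exists x.
by rewrite !size_map oddM negb_and odd_size_flatten.
Qed.

Lemma word_term_cons A l L : word_term A (l :: L) =
  (-1) ^+ ord_inversions l * word_entry A l
  * (-1) ^+ cross_inv (map val l) (map val (flatten L)) * word_term A L.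
Proof.
rewrite /word_term big_cons /ord_inversions /= map_cat inv_cat !exprD -!mulrA; congr (_ * _).
by rewrite mulrCA [_ ^+ inversions _ * (_ * _)]mulrCA mulrCA.
Qed.

(** Sorting a decreasing pair removes one inversion and negates the entry; the cross inversions with
    the other pairs do not see the order inside a pair. *)
Lemma word_term_normal A L : (forall s t, A t s = - A s t) -> pairs L ->
  word_term A [seq enum [set x in l] | l <- L] = word_term A L.
Proof.
move=> A_skew; elim: L => //= l L IH /andP[/= /andP[/eqP sl allL]].
rewrite cat_uniq => /and3P[ul _ uL].
have pflat : perm_eq (flatten [seq enum [set x in l] | l <- L]) (flatten L).
  have {allL} := uL; elim: (L) => //= a M IHM; rewrite cat_uniq => /and3P[ua _ /IHM].
  apply: perm_cat; apply: uniq_perm => // [|x]; first exact: enum_uniq.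
  by rewrite mem_enum inE.
have pl : perm_eq (enum [set x in l]) l.
  by apply: uniq_perm => // [|x]; rewrite ?enum_uniq // mem_enum inE.
rewrite !word_term_cons IH /pairs ?allL //; congr (_ * _).
rewrite (perm_cross_inv (perm_map val pl) (perm_map val pflat)); congr (_ * _).
case: l sl ul {pl} => [|s [|t []]] //= _; rewrite inE andbT => st.
have -> : [set x in [:: s; t]] = [set s; t] by apply/setP => x; rewrite !inE.
rewrite enum_set2 //; case: ifP => //= ts.
rewrite /ord_inversions /= !addn0 A_skew.
move: ts st; case: ltngtP => // [ts _ _|/val_inj ->]; last by rewrite eqxx.
by rewrite expr0 expr1 mul1r mulN1r.
Qed.

Definition part_term A P : R :=
  (rearr_sign (id_word n) (pair_word P))%:~R * \prod_(B in P) pair_entry A B.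

Lemma PfE A : ~~ odd n -> Pf A = \sum_(P | pair_partition P) part_term A P.
Proof. by rewrite /Pf => /negPf ->. Qed.

Lemma perm_pair_word P : pair_partition P -> perm_eq (pair_word P) (enum 'I_n).
Proof.
case/andP=> pP _; apply/seq.permP => a.
(* Counting the letters with property [a] block by block counts each letter once, as the blocks
   partition [[n]]. *)
rewrite /pair_word count_flatten -map_comp sumnE big_map big_enum /=.
transitivity (\sum_(B in P) \sum_(x in B) a x)%N.
  apply: eq_bigr => B _; rewrite -big_enum -sum1_count [LHS]big_mkcond /=.
  by apply: eq_bigr => x _; case: (a x).
rewrite -(set_partition_big _ pP) -sum1_count [RHS]big_mkcond big_enum /=.
by apply: eq_big => x; rewrite ?inE //; case: (a x).
Qed.

Lemma all_size2_enum P : pair_partition P ->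
  all (fun l => size l == 2) [seq enum B | B : {set 'I_n} <- enum P].
Proof.
case/andP=> _ /forall_inP cP; apply/allP => _ /mapP[B BP ->].
by rewrite -cardE cP // -mem_enum.
Qed.

(** Frees the term of [P] from the listing chosen by [enum]: both the order of the pairs and the
    order within each pair may be picked at will. *)
Lemma part_termE A P L : (forall s t, A t s = - A s t) ->
  pair_partition P -> pairs L -> perm_eq [seq [set x in l] | l <- L] (enum P) ->
  part_term A P = word_term A L.
Proof.
move=> A_skew ppP pL pLP.
have pw := perm_pair_word ppP.
have -> : part_term A P = word_term A [seq enum B | B : {set 'I_n} <- enum P].
  rewrite /part_term /word_term rearr_signE // rmorphXn rmorphN1 big_map big_enum /=.
  by congr (_ * _); apply: eq_bigr => B _.
rewrite -(word_term_normal A_skew pL).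
have -> : [seq enum [set x in l] | l <- L]
    = [seq enum B | B : {set 'I_n} <- [seq [set x in l] | l <- L]].
  by rewrite -map_comp.
apply: perm_word_term; first by rewrite perm_sym perm_map.
by rewrite /pairs all_size2_enum //= (perm_uniq pw) enum_uniq.
Qed.
End Terms.

(** * Row expansion *)

Section EnumImset.
Variables (aT rT : finType) (f : aT -> rT).
Implicit Types B : {set aT}.

Lemma mem_map_enum B : map f (enum B) =i f @: B.
Proof.
move=> x; apply/mapP/imsetP => -[y yB ->]; exists y => //.
  by rewrite mem_enum in yB.
by rewrite mem_enum.
Qed.

Lemma set_map_enum B : [set x in map f (enum B)] = f @: B.
Proof. by apply/setP => x; rewrite inE mem_map_enum. Qed.

Lemma perm_enum_imset B : injective f -> perm_eq (map f (enum B)) (enum (f @: B)).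
Proof.
move=> inj_f; apply: uniq_perm; rewrite ?map_inj_uniq ?enum_uniq // => x.
by rewrite mem_map_enum mem_enum.
Qed.
End EnumImset.

(** * Simultaneous permutation of rows and columns *)

Section Conj.
Variables (R : comNzRingType) (n : nat) (A : 'M[R]_n).
Hypothesis A_skew : forall s t, A t s = - A s t.
Hypothesis n_even : ~~ odd n.

(** The term of [P] for the permuted matrix is compared with the term of the image of [P] under [s]
    for [A]: the entries coincide, and applying [s] to the word multiplies the sign by that of
    [s]. *)
Lemma Pf_perm (s : 'S_n) : Pf (mxsub s s A) = (-1) ^+ s * Pf A.
Proof.
have inj_s := @perm_inj _ s; have inj_ss := imset_inj inj_s.
have pp_s (P : {set {set 'I_n}}) :
    pair_partition [set s @: (B : {set _}) | B in P] = pair_partition P.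
  rewrite /pair_partition -[in LHS](_ : s @: [set: 'I_n] = setT) ?imset_partition //; last first.
    by apply/setP => x; rewrite inE -[x](permKV s) imset_f ?inE.
  congr (_ && _); apply/forall_inP/forall_inP => H B.
    by move=> BP; rewrite -(card_imset _ inj_s) H ?imset_f.
  by case/imsetP => C CP ->; rewrite card_imset ?H.
rewrite !PfE // [in RHS](reindex_inj (imset_inj inj_ss)) big_distrr /=.
apply: eq_big => [P|P ppP]; first by rewrite pp_s.
have pw := perm_pair_word ppP.
pose L := [seq enum B | B : {set 'I_n} <- enum P].
have allL := all_size2_enum ppP.
have flatL : flatten (map (map s) L) = map s (pair_word P) by rewrite map_flatten.
rewrite (@part_termE _ _ A _ (map (map s) L)) //; first last.
- rewrite -map_comp /L -map_comp (eq_map (g := fun B : {set 'I_n} => s @: B)).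
    exact: perm_enum_imset.
  by move=> B /=; apply: set_map_enum.
- rewrite /pairs flatL map_inj_uniq // (perm_uniq pw) enum_uniq andbT.
  by rewrite all_map; apply/allP => l lL /=; rewrite size_map; apply: (allP allL).
- by rewrite pp_s.
rewrite /part_term rearr_signE // rmorphXn rmorphN1 /word_term.
rewrite flatL mulrA; congr (_ * _).
  rewrite -(signr_odd _ (ord_inversions (map _ _))) odd_oinv_perm // signr_addb signr_odd.
  by rewrite signrMK.
rewrite !big_map big_enum /=; apply: eq_bigr => B BP.
rewrite /pair_entry /word_entry.
by case: (enum B) => [|x [|y []]] //=; rewrite mxE.
Qed.
End Conj.

Definition pf_adj (R : comNzRingType) n (A : 'M[R]_n) (s t : 'I_n) : R :=
  (word_sign (id_word n) [:: s; t])%:~R * Pf (del_mx A [set s; t]).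

Section Expansion.
Variables (R : comNzRingType) (n : nat) (A : 'M[R]_n).
Hypothesis A_skew : forall s t, A t s = - A s t.
Hypothesis n_even : ~~ odd n.

Lemma pf_adj_diag s : pf_adj A s s = 0.
Proof. by rewrite /pf_adj /word_sign /= inE eqxx /= andbF mul0r. Qed.

Let rest (s t : 'I_n) := [seq x <- enum 'I_n | x \notin [:: s; t]].

Lemma perm_rest s t : s != t -> perm_eq ([:: s; t] ++ rest s t) (enum 'I_n).
Proof.
move=> st; apply: uniq_perm; rewrite ?enum_uniq //.
  rewrite cat_uniq /= filter_uniq ?enum_uniq // inE st andbT /=.
  rewrite -all_predC andbT; apply/allP => x.
  by rewrite mem_filter => /andP[].
by move=> x; rewrite mem_cat mem_filter !mem_enum andbT orbN.
Qed.

(** The remaining word is increasing, so inversions involve [s] or [t]. This is the sign that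
    [word_term_cons] splits off for a leading pair. *)
Lemma word_sign2 s t : s != t -> word_sign (id_word n) [:: s; t] =
  (-1) ^+ ord_inversions [:: s; t] * (-1) ^+ cross_inv (map val [:: s; t]) (map val (rest s t)).
Proof.
move=> st; rewrite /word_sign enum_uniq /= inE st !mem_enum /=.
rewrite rearr_signE; last exact: perm_rest.
rewrite -[_ :: _]/([:: s; t] ++ rest s t).
rewrite /ord_inversions map_cat inv_cat (sorted_inv (w := map val (rest s t))) ?addn0 ?exprD //.
have -> : map val (rest s t) = filter (mem (map val (rest s t))) (map val (enum 'I_n)).
  rewrite filter_map; congr map; rewrite /rest; apply: eq_filter => x /=.
  by rewrite (mem_map val_inj) mem_filter mem_enum andbT.
by rewrite val_enum_ord; apply: sorted_filter ltn_trans _ _ (iota_ltn_sorted 0 n).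
Qed.

(** The deleted set and the cross inversions are symmetric in [s] and [t]; only the inversion
    between [s] and [t] themselves flips. *)
Lemma pf_adj_skew s t : pf_adj A t s = - pf_adj A s t.
Proof.
have [->|st] := eqVneq s t; first by rewrite pf_adj_diag oppr0.
have ts : t != s by rewrite eq_sym.
rewrite /pf_adj setUC -mulNr; congr (_ * _); rewrite -rmorphN; congr (_%:~R).
rewrite !word_sign2 // -mulNr; congr (_ * (-1) ^+ _).
  rewrite /ord_inversions /= !addn0; move: st; case: ltngtP => // /val_inj ->.
  by rewrite eqxx.
have -> : rest t s = rest s t.
  by apply: eq_filter => x; rewrite !inE orbC.
by apply: perm_cross_inv => //; apply: permEl (perm_catC [:: val t] [:: val s]).
Qed.

Lemma card_setC2 (s t : 'I_n) : s != t -> (#|~: [set s; t]| + 2)%N = n.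
Proof. by move=> st; rewrite addnC -[in RHS](card_ord n) -(cardsC [set s; t]) cards2 st. Qed.

(** Pair partitions containing [{s, t}] correspond to pair partitions of the complement, relabelled
    by [enum_val], and the terms differ by the factor of the leading pair. *)
Lemma sum_part_term_block s t : s != t ->
  \sum_(P | pair_partition P && ([set s; t] \in P)) part_term A P = A s t * pf_adj A s t.
Proof.
move=> st; set D := ~: [set s; t].
pose ev : 'I_#|D| -> 'I_n := enum_val.
have inj_ev : injective ev by apply: enum_val_inj.
have inj_eev := imset_inj inj_ev.
pose up (Q : {set {set 'I_#|D|}}) := [set ev @: (B : {set _}) | B in Q].
have evT : ev @: setT = D.
  apply/setP => x; apply/imsetP/idP => [[y _ ->]|xD]; first exact: enum_valP.
  by exists (enum_rank_in xD x); rewrite // /ev enum_rankK_in.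
have pp_up Q : pair_partition Q = partition (up Q) D && [forall B in up Q, #|B| == 2].
  rewrite /pair_partition -[X in _ = partition _ X && _]evT imset_partition //; congr (_ && _).
  apply/forall_inP/forall_inP => H B.
    by case/imsetP => C CQ ->; rewrite card_imset ?H.
  by move=> BQ; rewrite -(card_imset _ inj_ev) H ?imset_f.
have st_up Q : [set s; t] \notin up Q.
  apply/imsetP => -[B _ E]; have: s \in [set s; t] by rewrite !inE eqxx.
  by rewrite {1}E => /imsetP[y _ sy]; have := enum_valP y; rewrite -/(ev y) -sy !inE eqxx.
pose h Q := [set s; t] |: up Q.
have inj_h : injective h.
  move=> Q1 Q2 /setP E; apply: (imset_inj inj_eev); apply/setP => B.
  have := E B; rewrite !inE; case: eqP => // -> _.
  by rewrite (negPf (st_up Q1)) (negPf (st_up Q2)).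
have disj : [disjoint [set s; t] & D] by rewrite -setI_eq0 setICr.
(* The preimage under [h] is found by removing the block [{s, t}] and pulling the other blocks back
   along [ev]. *)
have imh P : (pair_partition P && ([set s; t] \in P)) = (P \in h @: [set Q | pair_partition Q]).
  apply/andP/imsetP => [[/andP[pP /forall_inP cP] stP]|[Q]].
    have pP' := partitionD1 pP stP.
    pose Q := [set B : {set 'I_#|D|} | ev @: B \in P :\ [set s; t]].
    have EQ : up Q = P :\ [set s; t].
      apply/setP => B; apply/imsetP/idP => [[C + ->]|BP]; first by rewrite inE.
      have EB : ev @: (ev @^-1: B) = B.
        apply/setP => x; apply/imsetP/idP => [[y + ->]|xB]; first by rewrite inE.
        have xD : x \in D by move: (subsetP (partitionS pP' BP) x xB); rewrite setTD.
        by exists (enum_rank_in xD x); rewrite ?inE /ev enum_rankK_in.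
      by exists (ev @^-1: B); rewrite ?inE EB //; move: BP; rewrite !inE.
    exists Q; last by rewrite /h EQ setD1K.
    rewrite inE pp_up EQ -[D]setTD pP' /=.
    by apply/forall_inP => B; rewrite inE => /andP[_ /cP].
  rewrite inE pp_up => /andP[pQ /forall_inP cQ] ->; split; last by rewrite !inE eqxx.
  apply/andP; split.
    rewrite -(setUCr [set s; t]); apply: partitionU1 => //.
    by apply/set0Pn; exists s; rewrite !inE eqxx.
  apply/forall_inP => B; rewrite !inE => /orP[/eqP ->|/cQ //].
  by rewrite cards2 st.
rewrite (eq_bigl _ _ imh) big_imset /=; last by move=> ? ? _ _; apply: inj_h.
rewrite /pf_adj PfE; last first.
  by have := congr1 odd (card_setC2 st); rewrite oddD addbF => ->.
rewrite big_distrr big_distrr /=; apply: eq_big => [Q|Q]; rewrite inE // => ppQ.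
have := ppQ; rewrite pp_up => /andP[pQ _].
have pw := perm_pair_word ppQ.
pose L := [seq enum B | B : {set 'I_#|D|} <- enum Q].
have allL := all_size2_enum ppQ.
have setL : [seq [set x in l] | l <- map (map ev) L] = [seq ev @: B | B : {set _} <- enum Q].
  by rewrite -!map_comp; apply: eq_map => B /=; apply: set_map_enum.
have pflat : perm_eq (map ev (pair_word Q)) (rest s t).
  apply: uniq_perm.
  - by rewrite map_inj_uniq // (perm_uniq pw) enum_uniq.
  - exact/filter_uniq/enum_uniq.
  move=> x; rewrite mem_filter mem_enum andbT.
  have -> : (x \notin [:: s; t]) = (x \in ev @: setT) by rewrite evT !inE.
  apply/mapP/imsetP => -[y _ ->]; exists y; rewrite ?inE //.
  by rewrite (perm_mem pw) mem_enum.
have flatL : flatten (map (map ev) L) = map ev (pair_word Q) by rewrite map_flatten.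
(* Listing [{s, t}] first makes the sign factor as in [word_sign2]. *)
rewrite (@part_termE _ _ A _ ([:: s; t] :: map (map ev) L)) //; first last.
- rewrite /= setL; have -> : [set x in [:: s; t]] = [set s; t].
    by apply/setP => x; rewrite !inE.
  apply: perm_trans (_ : perm_eq ([set s; t] :: enum (up Q)) _).
    by rewrite perm_cons; apply: perm_enum_imset.
  apply: uniq_perm; rewrite ?enum_uniq //= ?enum_uniq ?mem_enum ?st_up // => B.
  by rewrite mem_enum !inE mem_enum.
- apply/andP; split.
    by rewrite /= all_map; apply/allP => l lL /=; rewrite size_map; apply: (allP allL).
  rewrite -[flatten _]/([:: s; t] ++ flatten (map (map ev) L)) flatL.
  by rewrite (perm_uniq (perm_trans (perm_cat (perm_refl _) pflat) (perm_rest st))) enum_uniq.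
- suff /andP[] : pair_partition (h Q) && ([set s; t] \in h Q) by [].
  by rewrite imh imset_f // inE.
rewrite word_term_cons word_sign2 // rmorphM !rmorphXn !rmorphN1.
rewrite flatL (perm_cross_inv (perm_refl _) (perm_map val pflat)) /=.
rewrite -!mulrA mulrCA; congr (_ * (_ * (_ * _))).
rewrite /part_term rearr_signE // rmorphXn rmorphN1 /word_term.
rewrite flatL; congr (_ ^+ _ * _).
  rewrite /ord_inversions -map_comp; apply: (@inv_map_mono _ (val \o ev) val) => x y.
  exact: enum_val_ltn.
rewrite !big_map big_enum /=; apply: eq_bigr => B BP.
rewrite /pair_entry /word_entry.
by case: (enum B) => [|x [|y []]] //=; rewrite mxE.
Qed.

Lemma Pf_expand s : Pf A = \sum_t A s t * pf_adj A s t.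
Proof.
rewrite PfE //.
(* The terms are grouped by the partner of [s]. The default [s] stands for a missing partner, which
   [mateP] excludes. *)
pose mate (P : {set {set 'I_n}}) := odflt s [pick u | (u != s) && ([set s; u] \in P)].
rewrite (partition_big mate predT) //=; apply: eq_bigr => t _.
have mateP P : pair_partition P -> (mate P != s) && ([set s; mate P] \in P).
  rewrite /mate => /andP[pP /forall_inP cP]; case: pickP => [x -> //|] noP.
  have sP : s \in cover P by rewrite (cover_partition pP) inE.
  have := pblock_mem sP; move: sP; rewrite -mem_pblock.
  move: (pblock P s) => B sB BP; have := cP _ BP.
  case/cards2P => x [y [xy E]]; move: sB; rewrite {}E !inE in BP * => /orP[] /eqP sE; subst.
    by have := noP y; rewrite eq_sym xy BP.
  by have := noP x; rewrite xy setUC BP.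
(* For [t = s] the group is empty and the adjugate entry vanishes. *)
have [<-|st] := eqVneq s t.
  rewrite pf_adj_diag mulr0 big1 // => P /andP[/mateP /andP[+ _] /eqP E].
  by rewrite E eqxx.
rewrite -sum_part_term_block //; apply: eq_bigl => P.
apply: andb_id2l => ppP; have /andP[mP smP] := mateP P ppP.
apply/eqP/idP => [<- //|stP].
case/andP: ppP => pP _; have tI := partition_trivIset pP.
have: [set s; mate P] = [set s; t].
  by rewrite -(def_pblock tI stP (x := s)) ?(def_pblock tI smP) // !inE eqxx.
by move/setP/(_ t); rewrite !inE eqxx orbT (eq_sym t s) (negPf st) => /eqP.
Qed.
End Expansion.

(** * The Pfaffian adjugate *)

Section Adjugate.
Variables (R : numDomainType) (n : nat).
Implicit Types A B : 'M[R]_n.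
Let skew A := forall s t, A t s = - A s t.

(** Row and column [s] are deleted, so changes there are invisible. *)
Lemma eq_pf_adj A B s t :
  (forall x y, x != s -> y != s -> A x y = B x y) -> pf_adj A s t = pf_adj B s t.
Proof.
move=> AB; rewrite /pf_adj; congr (_ * Pf _); apply/matrixP => x y; rewrite !mxE.
have ne (z : 'I_#|~: [set s; t]|) : enum_val z != s.
  by have := enum_valP z; rewrite !inE => /norP[].
exact: AB.
Qed.

(* For [v != s] the left side expands the Pfaffian of [A] with row and column
   [s] replaced by [v], which is invariant under exchanging [s] and [v]. *)
Lemma sum_row_pf_adj A s v : skew A -> ~~ odd n ->
  \sum_t A v t * pf_adj A s t = (v == s)%:R * Pf A.
Proof.
move=> A_skew n_even; have [->|vs] := eqVneq v s.
  by rewrite mul1r -Pf_expand.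
rewrite mul0r; pose phi x := if x == s then v else x.
pose A' := mxsub phi phi A.
have A'_skew : skew A' by move=> x y; rewrite !mxE A_skew.
transitivity (Pf A').
  rewrite (Pf_expand A'_skew n_even s); apply: eq_bigr => t _.
  have [<-|st] := eqVneq s t; first by rewrite !pf_adj_diag !mulr0.
  rewrite mxE /phi eqxx eq_sym (negPf st); congr (_ * _).
  by apply: eq_pf_adj => x y xs ys; rewrite !mxE /phi (negPf xs) (negPf ys).
have := Pf_perm A'_skew n_even (tperm s v).
have -> : mxsub (tperm s v) (tperm s v) A' = A'.
  have phi_s x : phi (tperm s v x) = phi x.
    by rewrite /phi; case: tpermP => [->|->|] //; rewrite eqxx (negPf vs).
  by apply/matrixP => x y; rewrite !mxE !phi_s.
(* The exchange is odd, so [Pf A'] equals its own negative and vanishes because [2] can be cancelled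
   in [R]. *)
rewrite odd_tperm eq_sym vs expr1 mulN1r => /eqP.
by rewrite -addr_eq0 -mulr2n mulrn_eq0 => /eqP.
Qed.

Lemma pf_adj_bilinear A B s t : skew A -> skew B -> ~~ odd n ->
  \sum_u \sum_v (A u v - B u v) * (pf_adj A s u * pf_adj B t v)
  = Pf A * pf_adj B s t - Pf B * pf_adj A s t.
Proof.
move=> A_skew B_skew n_even.
under eq_bigr => u _ do (under eq_bigr => v _ do rewrite mulrBl; rewrite sumrB).
(* The part with [A] is summed over [u] first and collapses to [v = s]; the part with [B] is summed
   over [v] first and collapses to [u = t]. In the former, the sign from transposing [A] is absorbed
   by the skewness of [pf_adj B]. *)
rewrite sumrB exchange_big /=; congr (_ - _).
  transitivity (\sum_v - ((v == s)%:R * Pf A) * pf_adj B t v).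
    apply: eq_bigr => v _; rewrite -(sum_row_pf_adj s v A_skew n_even) -sumrN mulr_suml.
    by apply: eq_bigr => u _; rewrite (A_skew v u) mulrA mulNr.
  rewrite (bigD1 s) //= eqxx big1 ?addr0 => [|v /negPf ->]; last by rewrite mul0r oppr0 mul0r.
  by rewrite mul1r pf_adj_skew mulrNN.
transitivity (\sum_u pf_adj A s u * ((u == t)%:R * Pf B)).
  apply: eq_bigr => u _; rewrite -(sum_row_pf_adj t u B_skew n_even) mulr_sumr.
  by apply: eq_bigr => v _; rewrite mulrCA.
rewrite (bigD1 t) //= eqxx big1 ?addr0 => [|v /negPf ->]; last by rewrite mul0r mulr0.
by rewrite mul1r mulrC.
Qed.

(* [s] and [t] enter the Pfaffian together only through [A s t]. *)
Lemma Pf_update_entry A B s t : skew A -> skew B -> ~~ odd n ->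
  (forall x y, (x, y) != (s, t) -> (y, x) != (s, t) -> A x y = B x y) ->
  Pf A - Pf B = (A s t - B s t) * pf_adj A s t.
Proof.
move=> A_skew B_skew n_even AB.
rewrite (Pf_expand A_skew n_even s) (Pf_expand B_skew n_even s) -sumrB.
rewrite (bigD1 t) //= big1 ?addr0 => [|u ut].
  rewrite mulrBl; congr (_ - _ * _); apply: eq_pf_adj => x y xs ys.
  by rewrite AB // xpair_eqE negb_and ?xs ?ys.
have [<-|su] := eqVneq s u; first by rewrite !pf_adj_diag !mulr0 subrr.
rewrite (@eq_pf_adj A B s u) => [|x y xs ys]; last first.
  by rewrite AB // xpair_eqE negb_and ?xs ?ys.
by rewrite AB ?subrr // xpair_eqE negb_and ?ut ?orbT // eq_sym su.
Qed.

(** * Erasing the entries of [E] *)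

Lemma zero_mx_skew (E : {set 'I_n * 'I_n}) A : skew A -> skew (zero_mx E A).
Proof. by move=> A_skew s t; rewrite !mxE orbC; case: ifP; rewrite ?oppr0. Qed.

(** The difference of the matrices lives on [E] and its transpose. These are disjoint since pairs in
    [E] increase, and skewness merges the two contributions of a pair. *)
Lemma sum_zero_mx (E : {set 'I_n * 'I_n}) A (X Y : 'I_n -> R) : skew A ->
  (forall e, e \in E -> (e.1 < e.2)%N) ->
  \sum_u \sum_v (A u v - zero_mx E A u v) * (X u * Y v)
  = \sum_(e in E) A e.1 e.2 * (X e.1 * Y e.2 - X e.2 * Y e.1).
Proof.
move=> A_skew ltE; pose F u v := A u v * (X u * Y v).
transitivity (\sum_u \sum_v (if (u, v) \in E then F u v else 0)
            + \sum_u \sum_v (if (v, u) \in E then F u v else 0)).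
  rewrite -big_split; apply: eq_bigr => u _; rewrite -big_split.
  apply: eq_bigr => v _; rewrite mxE /=.
  case: (boolP ((u, v) \in E)) => [uv|_]; case: (boolP ((v, u) \in E)) => [vu|_] //=;
    rewrite ?subr0 ?subrr ?mul0r ?addr0 ?add0r //.
  by have := ltn_trans (ltE _ uv) (ltE _ vu); rewrite ltnn.
rewrite [X in _ + X]exchange_big !pair_big /= -!big_mkcond -big_split /=.
apply: eq_big => [[u v]|[u v] _] //=; rewrite /F (A_skew u v).
by ring.
Qed.
End Adjugate.

(** * The product identity, from the bilinear identity and two one-entry updates *)

Theorem corollary3p2 (R : realType) (n : nat) (n_even : ~~ odd n)
    (A : 'M[R]_n) (A_skew : A^T = - A)
    (k : nat) (k_gt0 : (0 < k)%N) (i j : 'I_k -> 'I_n)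
    (ij_inj : injective (fun l : 'I_k => (i l, j l)))
    (i_sorted : forall l m : 'I_k, (l <= m)%N -> (i l <= i m)%N)
    (ij_lt : forall l : 'I_k, (i l < j l)%N)
    (p : 'I_k) :
  let E := [set (i l, j l) | l : 'I_k] in
  let Ep := E :\ (i p, j p) in
  let Ep_bar := [set (i p, j p)] in
  let f (l : 'I_k) : int := word_sign (id_word n) [:: i p; j l]
                            * word_sign (id_word n) [:: j p; i l] in
  let g (l : 'I_k) : int := word_sign (id_word n) [:: i p; i l]
                            * word_sign (id_word n) [:: j p; j l] in
  Pf (zero_mx E A) * Pf A =
    Pf (zero_mx Ep A) * Pf (zero_mx Ep_bar A)
    + A (i p) (j p) *
      \sum_(l < k | l != p) A (i l) (j l) *
        ((f l)%:~R * Pf (del_mx (zero_mx E A) [set j p; i l])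
                   * Pf (del_mx A [set i p; j l])
         - (g l)%:~R * Pf (del_mx (zero_mx E A) [set j p; j l])
                     * Pf (del_mx A [set i p; i l])).
Proof.
move=> E Ep Ep_bar f g.
have skewA s t : A t s = - A s t by move/matrixP/(_ s t): A_skew; rewrite !mxE.
have skewZ F : forall s t, zero_mx F A t s = - zero_mx F A s t := zero_mx_skew F skewA.
have ltE e : e \in E -> (e.1 < e.2)%N by case/imsetP => l _ ->; apply: ij_lt.
have pE : (i p, j p) \in E by apply: imset_f.
have gtE : (j p, i p) \notin E by apply/negP => /ltE /=; rewrite ltnNge ltnW.
pose B := zero_mx E A; pose a := A (i p) (j p).
pose X := pf_adj A (i p); pose Y := pf_adj B (j p).
have EA : Pf A - Pf (zero_mx Ep_bar A) = a * pf_adj A (i p) (j p).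
  rewrite (@Pf_update_entry _ _ _ (zero_mx Ep_bar A) (i p) (j p)) // => [|x y xy yx].
    by rewrite mxE inE eqxx subr0.
  by rewrite mxE !inE (negPf xy) (negPf yx).
have EB : Pf (zero_mx Ep A) - Pf B = a * pf_adj B (i p) (j p).
  (* The difference is reversed so that [Pf_update_entry] yields the adjugate of [B]; the entry of
     [B] at [(i p, j p)] is [0], that of [E_p(A)] is [a]. *)
  apply: oppr_inj; rewrite opprB -mulNr.
  rewrite (@Pf_update_entry _ _ B (zero_mx Ep A) (i p) (j p)
    (skewZ E) (skewZ Ep) n_even) => [|x y xy yx].
    by rewrite !mxE pE !inE eqxx (negPf gtE) andbF sub0r.
  by rewrite !mxE !inE xy yx.
have sumE : \sum_l A (i l) (j l) * (X (j l) * Y (i l) - X (i l) * Y (j l))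
    = Pf B * pf_adj A (i p) (j p) - Pf A * pf_adj B (i p) (j p).
  rewrite -[RHS]opprB -(pf_adj_bilinear _ _ skewA (skewZ E) n_even) sum_zero_mx //.
  rewrite big_imset /=; last first.
    by move=> l m _ _; apply: ij_inj.
  by rewrite -sumrN; apply: eq_bigr => l _; rewrite -[RHS]mulrN opprB.
have -> : Pf (zero_mx Ep A) = Pf B + a * pf_adj B (i p) (j p) by rewrite -EB addrC subrK.
have -> : Pf (zero_mx Ep_bar A) = Pf A - a * pf_adj A (i p) (j p) by rewrite -EA subKr.
have -> : \sum_(l < k | l != p) A (i l) (j l) *
        ((f l)%:~R * Pf (del_mx (zero_mx E A) [set j p; i l])
                   * Pf (del_mx A [set i p; j l])
         - (g l)%:~R * Pf (del_mx (zero_mx E A) [set j p; j l])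
                     * Pf (del_mx A [set i p; i l]))
   = \sum_(l < k | l != p) A (i l) (j l) * (X (j l) * Y (i l) - X (i l) * Y (j l)).
  (* Each of [f l] and [g l] is a product of two word signs, one absorbed into [X] and one into
     [Y]. *)
  by apply: eq_bigr => l _; congr (_ * (_ - _));
    rewrite rmorphM -mulrA [X in _ * X]mulrC mulrACA.
have Xip : X (i p) = 0 by apply: pf_adj_diag.
have Yip : Y (i p) = - pf_adj B (i p) (j p) by apply: pf_adj_skew.
(* The summand [p] is [- a * X (j p) * pf_adj B (i p) (j p)]. Moved across and multiplied by [a], it
   cancels the quadratic term of the product of the two updated Pfaffians. *)
move: sumE; rewrite (bigD1 p) //= -/a Xip Yip => /(canRL (addKr _)) ->.
by rewrite -/B /X; ring.
Qed.
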